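(* (1) Let $3\le t\le 6$ and let $p_1,\dots,p_t$ be distinct primes with $p_i\le 19$ for $i=1,\dots,t$. Then every solution in non-negative integers $\alpha_1,\dots,\alpha_t$ of $$p_1^{\alpha_1}+\dots+p_{t-1}^{\alpha_{t-1}}-p_t^{\alpha_t}=0$$ satisfies $\min_{1\le i\le t}\alpha_i\le 15$. (2) The equation $$3^{\alpha_1}+5^{\alpha_2}+11^{\alpha_3}+13^{\alpha_4}+17^{\alpha_5}-19^{\alpha_6}=0$$ has exactly two solutions in non-negative integers $\alpha_1,\dots,\alpha_6$, namely $(\alpha_1,\dots,\alpha_6)=(0,1,1,0,0,1)$ and $(1,0,0,1,0,1)$. *)

(* Defs.v *)
From mathcomp Require Export all_boot.

(* Main.v *)
(** Each equation is refuted by congruences. Modulo a prime power [q], the power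
    [p ^ a] depends only on the residue of [a] modulo the order of [p] (or vanishes,
    when [p] divides [q] and [a] is large), so a residue class of exponent
    vectors survives [q] only if the equation holds for it modulo [q]. Choosing
    moduli [q] whose group of units has a smooth order keeps the number of
    surviving classes small, and after a few dozen moduli none is left. A
    solution with small exponents survives every modulus in which no term
    vanishes; it dies at a modulus [p ^ j] with [j] above its exponent of [p].

    In (2), an exponent [0] is treated by replacing the base by [1], so that the
    other exponents are positive; [a6 <= 1] leaves finitely many cases. *)

Require Import Defs.
From Stdlib Require Import BinNat MSetPositive.

Set Implicit Arguments.
Unset Strict Implicit.
Unset Printing Implicit Defensive.

(** * Binary arithmetic and modular powers *)

Lemma nat_of_add_bin (x y : N) : (x + y)%num = x + y :> nat.
Proof. by case: x y => [|x] [|y] //=; rewrite ?addn0 // nat_of_add_pos. Qed.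

Lemma nat_of_mul_bin (x y : N) : (x * y)%num = x * y :> nat.
Proof. by case: x y => [|x] [|y] //=; rewrite ?muln0 // nat_of_mul_pos. Qed.

Lemma nat_of_mod_bin (x y : N) : 0 < y -> (x mod y)%num = x %% y :> nat.
Proof.
move=> y_gt0; have y_neq0 : y <> 0%num by move=> y0; rewrite y0 in y_gt0.
rewrite {2}(N.div_mod' x y) nat_of_add_bin nat_of_mul_bin mulnC modnMDl modn_small //.
have /N.le_succ_l/N.sub_add eq_y := N.mod_lt x _ y_neq0.
rewrite -[X in _ < nat_of_bin X]eq_y nat_of_add_bin -N.add_1_r nat_of_add_bin.
by rewrite addn1 addnS ltnS leq_addl.
Qed.

Fixpoint powm_pos (q g : N) (e : positive) : N :=
  match e with
  | xH => (g mod q)%num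
  | xO e => let h := powm_pos q g e in ((h * h) mod q)%num
  | xI e => let h := powm_pos q g e in ((h * h * g) mod q)%num
  end.

Definition powm (q g e : N) : N :=
  if e is Npos e' then powm_pos q g e' else (1 mod q)%num.

Lemma powmE (q g e : N) : 0 < q -> powm q g e = g ^ e %% q :> nat.
Proof.
move=> q_gt0; case: e => [|e] /=; first by rewrite nat_of_mod_bin.
elim: e => [e IHe|e IHe|] /=; last by rewrite nat_of_mod_bin ?expn1.
  rewrite nat_of_mod_bin // !nat_of_mul_bin IHe natTrecE expnS -addnn expnD.
  by rewrite mulnC -modnMmr modnMm modnMmr.
by rewrite nat_of_mod_bin // nat_of_mul_bin IHe natTrecE modnMm -addnn expnD.
Qed.

(** * Powers modulo [q] read off digits of the exponent *)

(** An exponent [a] is known through its residues modulo powers of the primes [r]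
    of [radices]: for each [r], a list of the first base-[r] digits of [a], least
    significant first, possibly empty. *)

Definition radices := [:: 2; 3; 5; 7; 11; 13; 17; 19].
Definition digits := seq (seq nat).

Fixpoint fits_at (r : nat) (d : seq nat) (x : nat) : bool :=
  if d is i :: d' then (i == x %% r) && fits_at r d' (x %/ r) else true.

Fixpoint fits (rs : seq nat) (ds : digits) (x : nat) : bool :=
  if ds is d :: ds' then fits_at (head 1 rs) d x && fits (behead rs) ds' x
  else true.

(** A walker represents the function [a |-> p ^ a mod q]. Given the digits known
    for the current radix and for the next radices, it lists the extensions of these
    digits that determine the value, paired with this value. *)
Definition walker := seq nat -> digits -> seq (digits * N).

Definition leaf (v : N) : walker := fun d ds => [:: (d :: ds, v)].

Definition next (w : walker) : walker := fun d ds =>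
  [seq (d :: c.1, c.2) | c <- w (head [::] ds) (behead ds)].

Definition node (ws : seq walker) : walker := fun d ds =>
  flatten [seq [seq ((x :: head [::] c.1) :: behead c.1, c.2)
               | c <- nth (leaf 0) ws x (behead d) ds]
          | x <- if d is x :: _ then [:: x] else iota 0 (size ws)].

Section Build.
Variable q : N.

Fixpoint powers (g v : N) (r : nat) : seq N :=
  if r is r'.+1 then v :: powers g ((v * g) mod q) r' else [::].

(** Reads digits by [g ^ x = g ^ (x %% r) * (g ^ r) ^ (x %/ r)]; if [g ^ (r ^ k)] is [1] modulo [q],
    nothing is left after [k] of them. *)
Fixpoint levels (r k : nat) (g v : N) (cont : N -> walker) : walker :=
  if k is k'.+1 then
    let g' := powm q g (bin_of_nat r) in
    node [seq levels r k' g' u cont | u <- powers g v r]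
  else cont v.

(** Each [(k, g)] is meant as the component of the base for one radix [r], of order dividing
    [r ^ k]: the value is [v] times the product of all [g ^ a], and each factor depends on [k]
    digits of [a]. *)
Fixpoint build (cs : seq (nat * N)) (rs : seq nat) (v : N) : walker :=
  match cs with
  | [::] => leaf v
  | [:: (k, g)] => levels (head 1 rs) k g v leaf
  | (k, g) :: cs' => levels (head 1 rs) k g v (fun u => next (build cs' (behead rs) u))
  end.

Hypothesis q_gt0 : 0 < q.

(** [x] is the quotient of the exponent [a] by the power of the current radix
    accounted for by the digits already read. *)
Definition sound (rs : seq nat) (x a : nat) (w : walker) (u : nat) :=
  forall d ds, fits_at (head 1 rs) d x -> fits (behead rs) ds a ->
  exists c, [/\ c \in w d ds, fits_at (head 1 rs) (head [::] c.1) x,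
                fits (behead rs) (behead c.1) a, c.2 <= q & c.2 = u %[mod q]].

Lemma sound_leaf rs x a (v : N) u : v <= q -> v = u %[mod q] -> sound rs x a (leaf v) u.
Proof.
by move=> le_vq eq_vu d ds fd fds; exists (d :: ds, v); split; rewrite ?mem_head.
Qed.

Lemma sound_next rs x a w t :
  sound (behead rs) a a w t -> sound rs x a (next w) t.
Proof.
move=> sw d ds fd fds.
have [||c [w_c fh ft le_c eq_c]] := sw (head [::] ds) (behead ds).
- by case: ds fds => //= d' ds /andP[].
- by case: ds fds => //= d' ds /andP[].
exists (d :: c.1, c.2); split=> //=; first by apply/mapP; exists c.
by case: c.1 fh ft => //= d' ds' -> ->.
Qed.

Lemma sound_node rs x a ws t :
    head 1 rs = size ws -> 0 < size ws ->
    sound rs (x %/ size ws) a (nth (leaf 0) ws (x %% size ws)) t ->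
  sound rs x a (node ws) t.
Proof.
move=> rs_ws ws_gt0 sw d ds fd fds.
have [||c [w_c fh ft le_c eq_c]] := sw (behead d) ds => //.
  by case: d fd => //= i d; rewrite rs_ws => /andP[].
exists ((x %% size ws :: head [::] c.1) :: behead c.1, c.2); split=> //=.
  apply/flatten_mapP; exists (x %% size ws); last by apply/mapP; exists c.
  case: d fd {w_c} => [|i d] /=; first by rewrite mem_iota ltn_mod.
  by rewrite rs_ws => /andP[/eqP-> _]; rewrite mem_head.
by rewrite rs_ws in fh *; rewrite eqxx.
Qed.

Lemma size_powers g v r : size (powers g v r) = r.
Proof. by elim: r v => //= r IHr v; rewrite IHr. Qed.

Lemma nth_powers (g v : N) r i : v <= q -> i < r ->
  nth 0%num (powers g v r) i <= q
  /\ nth 0%num (powers g v r) i = v * g ^ i %[mod q].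
Proof.
elim: r v i => // r IHr v [|i] le_vq lt_ir /=; first by rewrite muln1.
have [|//|le_n ->] := IHr ((v * g) mod q)%num i.
  by rewrite nat_of_mod_bin // ltnW // ltn_mod.
by split=> //; rewrite nat_of_mod_bin // nat_of_mul_bin modnMml expnS mulnA.
Qed.

Lemma sound_levels rs k (g v : N) cont x a t :
    0 < head 1 rs -> g ^ (head 1 rs ^ k) = 1 %[mod q] -> v <= q ->
    (forall (u : N) y, u <= q -> u = v * g ^ x %[mod q] ->
       sound rs y a (cont u) t) ->
  sound rs x a (levels (head 1 rs) k g v cont) t.
Proof.
move=> r_gt0; set r := head 1 rs in r_gt0 *.
elim: k g v x => [|k IHk] g v x /= gk1 le_vq scont.
  rewrite expn1 in gk1; apply: scont => //.
  by rewrite -modnMmr -modnXm gk1 modnXm exp1n modnMmr muln1.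
have [le_u eq_u] := nth_powers g le_vq (ltn_pmod x r_gt0).
apply: sound_node; rewrite size_map size_powers //.
rewrite (nth_map 0%num) ?size_powers ?ltn_mod //; apply: IHk => // [|u y le_uq eq_uq].
  by rewrite powmE // bin_of_natK modnXm -expnM -expnS.
apply: scont => //; rewrite eq_uq -modnMml eq_u modnMml -modnMmr powmE //.
rewrite bin_of_natK modnXm modnMmr -expnM -mulnA -expnD.
by rewrite (mulnC (head 1 rs)) addnC -divn_eq.
Qed.

Definition has_order (r k : nat) (g : N) : bool :=
  iter k (fun h => powm q h (bin_of_nat r)) g == 1%num.

Lemma has_orderP r k g : has_order r k g -> g ^ (r ^ k) = 1 %[mod q].
Proof.
move/eqP; elim: k g => [|k IHk] g; first by move=> /= ->.
rewrite iterSr => /IHk <-.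
by rewrite powmE // modnXm bin_of_natK -expnM -expnS.
Qed.

Lemma sound_build (cs : seq (nat * N)) rs (v : N) x a t :
    all (fun r => 0 < r) rs -> v <= q ->
    all (fun c => has_order c.1 c.2.1 c.2.2) (zip rs cs) ->
    size cs <= size rs -> x = a \/ cs = [::] ->
    t = v * (\prod_(c <- cs) nat_of_bin c.2) ^ a %[mod q] ->
  sound rs x a (build cs rs v) t.
Proof.
elim: cs rs v x => [|[k g] cs IHcs] [|r rs] v x //= rs_gt0 le_vq ok_cs le_cs.
- by move=> _ eq_t; apply: sound_leaf => //; rewrite eq_t big_nil exp1n muln1.
- by move=> _ eq_t; apply: sound_leaf => //; rewrite eq_t big_nil exp1n muln1.
case=> // -> eq_t; case/andP: rs_gt0 => r_gt0 rs_gt0.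
case/andP: ok_cs => /has_orderP gk1 ok_cs.
suff scont (u : N) y : u <= q -> u = v * g ^ a %[mod q] ->
    sound (r :: rs) y a (next (build cs rs u)) t.
  case: cs => [|c cs] in IHcs ok_cs le_cs eq_t scont *.
    apply: (@sound_levels (r :: rs)) => //= u y le_u eq_u.
    by apply: sound_leaf => //; rewrite eq_u eq_t big_seq1.
  by apply: (@sound_levels (r :: rs)) => //= u y le_u eq_u; apply: scont.
move=> le_u eq_u; apply: sound_next; apply: IHcs => //; last first.
- by rewrite eq_t big_cons expnMn mulnA -modnMml -eq_u modnMml.
- by left.
Qed.

Lemma sound_head ds x w t : sound radices x x w t -> fits radices ds x ->
  exists c, [/\ c \in w (head [::] ds) (behead ds), fits radices c.1 x,
                c.2 <= q & c.2 = t %[mod q]].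
Proof.
move=> sw fds; have [||c [w_c fh ft le_c eq_c]] := sw (head [::] ds) (behead ds).
- by case: ds fds => // d ds' /andP[].
- by case: ds fds => // d ds' /andP[].
exists c; split=> //; case: c.1 fh ft => // d ds' fh ft; exact/andP.
Qed.

(** * Sums of residues divisible by the modulus *)

Definition hit (M : PositiveSet.t) (v : N) : bool :=
  if v is Npos p then PositiveSet.mem p M else true.

Definition positives (f : nat -> N) (s : seq nat) : PositiveSet.t :=
  foldr (fun i M => if f i is Npos p then PositiveSet.add p M else M)
        PositiveSet.empty s.

Lemma hit_positives f s i : i \in s -> hit (positives f s) (f i).
Proof.
elim: s => //= j s IHs; rewrite inE => /predU1P[<-|/IHs].
  by case: (f i) => // p; apply/PositiveSet.mem_spec/PositiveSet.add_spec; left.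
case: (f i) => // p /PositiveSet.mem_spec p_in.
case: (f j) => [|p']; apply/PositiveSet.mem_spec => //.
by apply/PositiveSet.add_spec; right.
Qed.

(** An equation has at most six terms, each of value at most [q]. *)
Definition multiples : PositiveSet.t :=
  positives (fun i => (bin_of_nat i * q)%num) (iota 0 7).

Lemma hit_multiples (v : N) : q %| v -> v <= 6 * q -> hit multiples v.
Proof.
case/dvdnP=> i eq_v; rewrite eq_v leq_pmul2r // => le_i6.
have {eq_v} -> : v = (bin_of_nat i * q)%num.
  by rewrite -[LHS]nat_of_binK -[RHS]nat_of_binK nat_of_mul_bin bin_of_natK eq_v.
by apply: (@hit_positives (fun i => bin_of_nat i * q)%num); rewrite mem_iota.
Qed.
End Build.

(** The variables whose value is already determined are summed once and for all, and
    [combine] skips them. *)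
Fixpoint base (ls : seq (seq (digits * N))) : N :=
  match ls with
  | [::] => 0%num
  | [:: c] :: ls' => (c.2 + base ls')%num
  | _ :: ls' => base ls'
  end.

Fixpoint combine (M : PositiveSet.t) (ls : seq (seq (digits * N))) (acc : N) :
    seq (seq digits) :=
  match ls with
  | [::] => if hit M acc then [:: [::]] else [::]
  | [:: c] :: ls' => [seq c.1 :: s | s <- combine M ls' acc]
  | l :: ls' =>
      flatten [seq [seq c.1 :: s | s <- combine M ls' (acc + c.2)%num] | c <- l]
  end.

(** The sieve starts from [acc = base ls], so that [n] is the full sum; with [base ls] on the right,
    a skipped singleton cancels from both sides in the induction. *)
Lemma combine_complete M ls s (acc : N) n :
    all2 (fun c l => c \in l) s ls ->
    acc + \sum_(c <- s) nat_of_bin c.2 = base ls + n ->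
    (forall v : N, v = n :> nat -> hit M v) ->
  [seq c.1 | c <- s] \in combine M ls acc.
Proof.
move=> s_ls eq_n hit_n; elim: ls s acc => [|l ls IHls] [|c s] acc //= in s_ls eq_n *.
  by rewrite big_nil addn0 in eq_n; rewrite hit_n // mem_head.
case/andP: s_ls => c_l s_ls; rewrite big_cons in eq_n.
have in_flatten : acc + c.2 + \sum_(c <- s) nat_of_bin c.2 = base ls + n ->
    c.1 :: [seq c.1 | c <- s] \in
      flatten [seq [seq c.1 :: s | s <- combine M ls (acc + c.2)%num] | c <- l].
  move=> eq_n'; apply/flatten_mapP; exists c => //; apply/mapP.
  by exists [seq c.1 | c <- s] => //; apply: IHls => //; rewrite nat_of_add_bin.
case: l => [|c0 [|c1 l]] in c_l eq_n in_flatten *; rewrite ?addnA in eq_n => //.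
  rewrite inE in c_l; rewrite (eqP c_l) in eq_n *; apply/mapP.
  exists [seq c.1 | c <- s] => //; apply: IHls => //.
  by apply: (@addnI c0.2); rewrite addnA [c0.2 + acc]addnC eq_n nat_of_add_bin addnA.
exact: in_flatten.
Qed.

(** * Splitting a base into components of prime-power order *)

Lemma nat_of_pred_bin (x : N) : 0 < x -> (x - 1)%num = x - 1 :> nat.
Proof.
move=> x_gt0; have x_neq0 : x <> 0%num by move=> x0; rewrite x0 in x_gt0.
by rewrite N.sub_1_r -[in RHS](N.succ_pred x x_neq0) -N.add_1_r nat_of_add_bin addnK.
Qed.

(** The pair [(b, j)] stands for the modulus [b ^ j]. *)
Definition modulus (m : nat * nat) : N := iter m.2 (N.mul (bin_of_nat m.1)) 1%num.

Fixpoint prime_to (fuel : nat) (r n : N) : N :=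
  if fuel is fuel'.+1 then
    if (n mod r == 0)%num then prime_to fuel' r (n / r)%num else n
  else n.

Fixpoint height (fuel : nat) (q : N) (r : nat) (g : N) : nat :=
  if fuel is fuel'.+1 then
    if g == 1%num then 0 else (height fuel' q r (powm q g (bin_of_nat r))).+1
  else 0.

(** With [n] the order of the group of units, [n = n' R] and [R] the [r]-part of [n], the
    exponent [n' ^ (R - R / r)] is [1] modulo [R] and [0] modulo [n'] by Euler's
    theorem; so [g] is the [r]-component of [p]. Correctness is checked a
    posteriori in [power_entry]. *)
Definition components (m : nat * nat) (p : N) : seq (nat * N) :=
  let q := modulus m in
  let n := (modulus (m.1, m.2.-1) * (bin_of_nat m.1 - 1))%num in
  let component r :=
    let n' := prime_to 20 (bin_of_nat r) n in
    let R := (n / n')%num in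
    let g := powm q p (powm n n' (R - R / bin_of_nat r)%num) in
    (height 20 q r g, g) in
  foldr (fun r cs => let c := component r in
           if nilp cs && (c.1 == 0) then [::] else c :: cs)
        [::] radices.

(** The walkers of [p ^ a] and of its opposite, valid for exponents [a >= j] if the
    first component is [Some j]; [None] if the check failed. *)
Definition entry : Type := option nat * (walker * walker).

Definition power_entry (m : nat * nat) (p : nat) : entry :=
  let q := modulus m in
  if p == m.1 then (Some m.2, (leaf 0, leaf 0))
  else
    let cs := components m (bin_of_nat p) in
    let ok := [&& size cs <= size radices,
                  all (fun c => has_order q c.1 c.2.1 c.2.2) (zip radices cs)
                & foldr (fun c v => (c.2 * v) mod q)%num 1%num cs
                  == (bin_of_nat p mod q)%num] in
    (if ok then Some 0 else None, (build q cs radices 1, build q cs radices (q - 1))).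

Definition walker_of (e : entry) (neg : bool) : walker :=
  if neg then e.2.2 else e.2.1.

Lemma modulusE m : modulus m = m.1 ^ m.2 :> nat.
Proof.
case: m => b; elim=> //= j IHj; rewrite /modulus iterS nat_of_mul_bin.
by rewrite bin_of_natK [in LHS]IHj expnS.
Qed.

Definition entry_sound (q : N) (p : nat) (e : entry) : Prop :=
  forall j a neg, e.1 = Some j -> j <= a ->
  sound q radices a a (walker_of e neg) ((if neg then q - 1 else 1) * p ^ a).

(** If [p = m.1], the power vanishes once [a >= m.2]. Otherwise the check [ok] suffices, however the
    components were found: their orders are as claimed and their product is [p]. *)
Lemma power_entry_sound m p : 0 < m.1 -> entry_sound (modulus m) p (power_entry m p).
Proof.
move=> b_gt0 j a neg; rewrite /power_entry.
have q_gt0 : 0 < modulus m by rewrite modulusE expn_gt0 b_gt0.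
case: eqP => [-> [<-] le_ja | _].
  case: neg; apply: sound_leaf => //;
    by apply/esym/eqP; rewrite mod0n -/(dvdn _ _) modulusE dvdn_mull // dvdn_exp2l.
move: (components m (bin_of_nat p)) (modulus m) q_gt0 => cs q q_gt0 {m b_gt0}.
case: ifP => // /and3P[le_cs ok_cs /eqP prod_cs] _ _.
have {}prod_cs : \prod_(c <- cs) nat_of_bin c.2 = p %[mod q].
  rewrite -[p in RHS]bin_of_natK -[in RHS]modn_mod -nat_of_mod_bin // -prod_cs.
  elim: cs {le_cs ok_cs prod_cs} => [|c cs IHcs] /=; first by rewrite big_nil.
  by rewrite big_cons nat_of_mod_bin // nat_of_mul_bin modn_mod -modnMmr IHcs modnMmr.
have {}prod_cs v : v * p ^ a = v * (\prod_(c <- cs) nat_of_bin c.2) ^ a %[mod q].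
  by rewrite -modnMmr -modnXm -prod_cs modnXm modnMmr.
have q1 := nat_of_pred_bin q_gt0.
case: neg; apply: sound_build; rewrite ?prod_cs ?q1 ?leq_subr //; by left.
Qed.

(** * The sieve on classes of exponent vectors *)

(** The Boolean marks the subtracted term. *)
Definition signed_term (b : nat -> nat) (q : nat) (v : bool * nat) : nat :=
  (if v.1 then q - 1 else 1) * v.2 ^ b v.2.

Definition fits_all (b : nat -> nat) (vs : seq (bool * nat)) (s : seq digits) : bool :=
  all2 (fits radices) s [seq b v.2 | v <- vs].

(** [k] bounds the exponents from below. A modulus is skipped, keeping all classes, when some entry
    failed its check or is valid only above [k]. *)
Definition step (M : PositiveSet.t) (f : nat -> entry) (k : nat -> nat)
    (vs : seq (bool * nat)) (cls : seq (seq digits)) : seq (seq digits) :=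
  if cls is [::] then [::] else
  let es := [seq (f v.2, v) | v <- vs] in
  if all (fun e => if e.1.1 is Some j then j <= k e.2.2 else false) es then
    let ws := [seq walker_of e.1 e.2.1 | e <- es] in
    flatten [seq let ls := [seq c.1 (head [::] c.2) (behead c.2) | c <- zip ws s] in
                 combine M ls (base ls)
            | s <- cls]
  else cls.

Lemma choose_digits (q : N) b vs s (W : bool * nat -> walker) :
    {in vs, forall v, sound q radices (b v.2) (b v.2) (W v) (signed_term b q v)} ->
    fits_all b vs s ->
  exists t : seq (digits * N),
    [/\ all2 (fun c l => c \in l) t
          [seq c.1 (head [::] c.2) (behead c.2) | c <- zip [seq W v | v <- vs] s],
        fits_all b vs [seq c.1 | c <- t],
        \sum_(c <- t) nat_of_bin c.2 <= size vs * q
      & \sum_(c <- t) nat_of_bin c.2 = \sum_(v <- vs) signed_term b q v %[mod q]].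
Proof.
rewrite /fits_all; elim: vs s => [|v vs IHvs] [|ds s] //= sW.
  by exists [::]; rewrite !big_nil.
case/andP=> fds /IHvs[v' v'_in|t [t_in ft le_t eq_t]].
  by apply: sW; rewrite inE v'_in orbT.
have [c [c_in fc le_c eq_c]] := sound_head (sW v (mem_head _ _)) fds.
exists (c :: t); split; rewrite /= ?c_in ?fc // !big_cons ?mulSn ?leq_add //.
by rewrite -modnDm eq_c eq_t modnDm.
Qed.

(** The class of a solution is never lost: its residues sum to a multiple of [q] that is at most
    [6 * q]. *)
Lemma step_complete (q : N) f k b vs cls s :
    0 < q -> {in vs, forall v, entry_sound q v.2 (f v.2)} ->
    {in vs, forall v, k v.2 <= b v.2} -> size vs <= 6 ->
    q %| \sum_(v <- vs) signed_term b q v ->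
    s \in cls -> fits_all b vs s ->
  exists2 s', s' \in step (multiples q) f k vs cls & fits_all b vs s'.
Proof.
move=> q_gt0 f_sound le_kb le6 q_dvd s_cls fs.
rewrite /step; case: cls s_cls => // s0 cls s_cls.
rewrite all_map; case: ifP => [/allP valid | _]; last by exists s.
have sW : {in vs, forall v, sound q radices (b v.2) (b v.2)
    (walker_of (f v.2) v.1) (signed_term b q v)}.
  move=> v v_in; have /= := valid v v_in.
  have := f_sound v v_in; case eq_j: (f v.2).1 => [j|] // fv le_jk.
  exact: fv eq_j (leq_trans le_jk (le_kb v v_in)).
have [t [t_in ft le_t eq_t]] := choose_digits sW fs.
exists [seq c.1 | c <- t] => //; apply/flatten_mapP; exists s => //.
rewrite -map_comp; apply: combine_complete t_in _ _; first by reflexivity.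
move=> v eq_v; apply: hit_multiples => //; rewrite eq_v.
  by rewrite /dvdn eq_t.
by rewrite (leq_trans le_t) // leq_mul2r le6 orbT.
Qed.

Definition bases := 1 :: radices.

Definition lookup (es : seq entry) (x : nat) : entry :=
  nth (None, (leaf 0, leaf 0)) es (index x bases).

Definition table (m : nat * nat) : PositiveSet.t * seq entry :=
  (multiples (modulus m), [seq power_entry m p | p <- bases]).

Lemma lookup_sound m x : 0 < m.1 ->
  entry_sound (modulus m) x (lookup (table m).2 x).
Proof.
move=> b_gt0; rewrite /lookup.
case: (boolP (x \in bases)) => [x_in|]; last first.
  (* Outside [bases] the default entry carries [None], so soundness is vacuous. *)
  by rewrite -index_mem -leqNgt => ge_x; rewrite nth_default ?size_map.
by rewrite (nth_map 0) ?index_mem // nth_index //; apply: power_entry_sound.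
Qed.

Definition sieve (tables : seq (PositiveSet.t * seq entry)) (ms : seq (nat * nat))
    (k : nat -> nat) (vs : seq (bool * nat)) : seq (seq digits) :=
  foldl (fun cls m => step (multiples (modulus m)) (power_entry m) k vs cls)
    (foldl (fun cls T => step T.1 (lookup T.2) k vs cls) [:: nseq (size vs) [::]] tables)
    ms.

Definition equation (xs : seq nat) (y : nat) : seq (bool * nat) :=
  (true, y) :: [seq (false, x) | x <- xs].

Lemma sieve_sound ms0 ms k xs y b :
    all (fun m => 0 < m.1) (ms0 ++ ms) -> size xs <= 5 ->
    sieve [seq table m | m <- ms0] ms k (equation xs y) = [::] ->
    {in y :: xs, forall x, k x <= b x} ->
  \sum_(x <- xs) x ^ b x != y ^ b y.
Proof.
rewrite all_cat => /andP[/allP ms0_gt0 /allP ms_gt0] le5 sieve0 le_kb.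
apply/eqP=> sum_eq; set vs := equation xs y in sieve0.
have le_kb' : {in vs, forall v, k v.2 <= b v.2}.
  move=> v; rewrite inE => /predU1P[->|/mapP[x x_in ->]]; apply: le_kb.
    exact: mem_head.
  by rewrite inE x_in orbT.
have le6 : size vs <= 6 by rewrite /= size_map.
have vs_dvd (q : nat) : 0 < q -> q %| \sum_(v <- vs) signed_term b q v.
  move=> q_gt0; rewrite big_cons big_map /signed_term /=.
  under eq_bigr do rewrite mul1n.
  (* The signed sum becomes [y ^ b y + (q - 1) * y ^ b y = q * y ^ b y]. *)
  by rewrite sum_eq addnC -mulSn subn1 prednK // dvdn_mulr.
pose good (cls : seq (seq digits)) := exists2 s, s \in cls & fits_all b vs s.
suff: good (sieve [seq table m | m <- ms0] ms k vs) by rewrite sieve0 => -[].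
have modulus_gt0 m : 0 < m.1 -> 0 < modulus m by rewrite modulusE expn_gt0 => ->.
have: good [:: nseq (size vs) [::]].
  exists (nseq (size vs) [::]); rewrite ?mem_head // /fits_all.
  by elim: vs {sieve0 le_kb' le6 vs_dvd good sum_eq} => //= v vs ->.
rewrite /sieve; move: [:: _] => cls.
elim: ms0 ms0_gt0 cls {sieve0} => [|m ms0 IHms0] ms0_gt0 cls /=.
  elim: ms ms_gt0 cls => //= m ms IHms ms_gt0 cls [s s_cls fs].
  have m_gt0 := ms_gt0 m (mem_head _ _).
  apply: IHms => [m' m'_in|]; first by apply: ms_gt0; rewrite inE m'_in orbT.
  apply: step_complete s_cls fs; rewrite ?vs_dvd ?modulus_gt0 // => v _.
  exact: power_entry_sound.
case=> s s_cls fs; have m_gt0 := ms0_gt0 m (mem_head _ _).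
apply: IHms0 => [m' m'_in|]; first by apply: ms0_gt0; rewrite inE m'_in orbT.
apply: step_complete s_cls fs; rewrite ?vs_dvd ?modulus_gt0 // => v _.
exact: lookup_sound.
Qed.

(** * The moduli and the equations to refute *)

(** Up to [(3, 6)] every unit group has order [2 ^ i * 3 ^ j], so only binary and ternary digits are
    refined; the last five moduli add one base-5 digit. *)
Definition moduli : seq (nat * nat) :=
  [:: (2, 1); (3, 1); (2, 2); (5, 1); (2, 4); (3, 2); (13, 1); (7, 1); (19, 1);
      (37, 1); (73, 1); (3, 3); (17, 1); (2, 6); (97, 1); (577, 1); (193, 1);
      (109, 1); (257, 1); (769, 1); (2, 10); (163, 1); (487, 1); (1459, 1);
      (3, 6); (31, 1); (11, 1); (61, 1); (41, 1); (5, 2)].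

(** Some class of exponents survives all of [moduli] for these equations, typically
    that of a small solution such as [2 ^ 10 + 11 ^ 3 + 13 ^ 3 + 19 ^ 2 = 17 ^ 3]. *)
Definition extra_moduli (xs : seq nat) (y : nat) : seq (nat * nat) :=
  let extras :=
    [:: ([:: 5; 7; 19], 3, [:: (1201, 1); (5, 3)]);
        ([:: 5; 11; 13], 7, [:: (1201, 1); (5, 3)]);
        ([:: 13; 17; 19], 7, [:: (409, 1); (1021, 1); (17, 2)]);
        ([:: 3; 5; 7; 11], 2, [:: (1321, 1); (331, 1); (1453, 1); (11, 3); (727, 1)]);
        ([:: 2; 5; 7; 11], 3, [:: (1321, 1); (661, 1); (11, 2)]);
        ([:: 3; 5; 11; 19], 2, [:: (1321, 1); (1409, 1); (11, 2)]);
        ([:: 3; 5; 13; 17], 2, [:: (71, 1); (449, 1); (547, 1); (937, 1); (13, 2)]);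
        ([:: 3; 5; 13; 19], 2, [:: (13, 2); (937, 1); (1171, 1)]);
        ([:: 2; 5; 13; 19], 3, [:: (601, 1); (251, 1); (751, 1); (5, 4)]);
        ([:: 2; 5; 7; 17], 13, [:: (601, 1); (251, 1); (751, 1); (5, 4)]);
        ([:: 2; 11; 13; 17], 7, [:: (1321, 1); (991, 1); (1453, 1); (11, 3)]);
        ([:: 7; 11; 13; 19], 2, [:: (13, 2); (937, 1)]);
        ([:: 2; 11; 13; 19], 17, [:: (2, 11); ((45 * 2 ^ 9).+1, 1)]);
        ([:: 3; 5; 11; 13; 17], 7, [:: (11, 2); (1409, 1); (991, 1)]);
        ([:: 3; 5; 13; 17; 19], 11,
          [:: (601, 1); (401, 1); (751, 1); (251, 1); (5, 4)]);
        ([:: 1; 5; 11; 1; 1], 19, [:: (1217, 1); (19, 2)]);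
        ([:: 3; 1; 1; 13; 1], 19, [:: (191, 1); (19, 2)])] in
  flatten [seq e.2 | e <- extras & e.1 == (xs, y)].

(** A constant, so that it is evaluated only once in the computations below. *)
Definition tables := [seq table m | m <- moduli].

Definition refuted (k : nat -> nat) (xs : seq nat) (y : nat) : bool :=
  let ms := extra_moduli xs y in
  all (fun m => 0 < m.1) ms && nilp (sieve tables ms k (equation xs y)).

Fixpoint sublists (s : seq nat) : seq (seq nat) :=
  if s is x :: s' then
    [seq x :: l | l <- sublists s'] ++ sublists s'
  else [:: [::]].

(** The thresholds for (2); base [1] stands for an exponent [0]. *)
Definition min_exponent (x : nat) : nat :=
  if x == 1 then 0 else if x == 19 then 2 else 1.

Fixpoint choices (s : seq nat) : seq (seq nat) :=
  if s is x :: s' then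
    [seq 1 :: l | l <- choices s'] ++ [seq x :: l | l <- choices s']
  else [:: [::]].

Lemma tablesE : tables = [seq table m | m <- moduli].
Proof. by []. Qed.

Lemma refutedP k xs y b : refuted k xs y -> size xs <= 5 ->
  {in y :: xs, forall x, k x <= b x} -> \sum_(x <- xs) x ^ b x != y ^ b y.
Proof.
rewrite /refuted tablesE => /andP[ms_gt0 /nilP sieve0] le5.
apply: sieve_sound le5 sieve0; rewrite all_cat ms_gt0 andbT.
by have: all (fun m => 0 < m.1) moduli by [].
Qed.

Lemma mem_sublists (a : pred nat) s : [seq x <- s | a x] \in sublists s.
Proof.
elim: s => //= x s IHs; rewrite mem_cat; case: (a x); last by rewrite IHs orbT.
by rewrite map_f.
Qed.

Lemma mem_choices (a : pred nat) s :
  [seq if a x then 1 else x | x <- s] \in choices s.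
Proof.
elim: s => //= x s IHs; rewrite mem_cat.
by case: (a x); rewrite map_f ?orbT.
Qed.

Lemma small_primes p : prime p -> p <= 19 -> p \in radices.
Proof. by do 20 (case: p => [|p] //). Qed.

(** As addition commutes, increasing lists cover all choices of summands; this leaves 896
    equations. *)
Lemma refuted_all16 :
  all (fun xs => all (refuted (fun=> 16) xs) [seq y <- radices | y \notin xs])
      [seq xs <- sublists radices | 1 < size xs <= 5].
Proof. by vm_cast_no_check (erefl true). Qed.

Lemma refuted_19 :
  all (fun xs => refuted min_exponent xs 19) (choices [:: 3; 5; 11; 13; 17]).
Proof. by vm_cast_no_check (erefl true). Qed.

(** * From refuted equations to the two statements *)

Lemma no_solution16 (s : seq nat) y b :
    uniq (y :: s) -> {subset y :: s <= radices} -> 1 < size s <= 5 ->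
    {in y :: s, forall x, 16 <= b x} ->
  \sum_(x <- s) x ^ b x != y ^ b y.
Proof.
move=> /= /andP[y_s s_uniq] s_sub size_s le_b.
pose xs := [seq x <- radices | x \in s].
have xs_s : perm_eq xs s.
  apply: uniq_perm => // [|x]; first by rewrite filter_uniq.
  by rewrite mem_filter andb_idr // => x_s; rewrite s_sub // inE x_s orbT.
rewrite -(perm_big _ xs_s) /=.
apply: (@refutedP (fun=> 16)); last first.
- by move=> x; rewrite inE (perm_mem xs_s) -in_cons; apply: le_b.
- by rewrite (perm_size xs_s); case/andP: size_s.
have /allP/(_ xs) := refuted_all16.
rewrite mem_filter (perm_size xs_s) size_s mem_sublists => /(_ isT)/allP; apply.
by rewrite mem_filter (perm_mem xs_s) y_s s_sub ?mem_head.
Qed.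

Lemma no_solution19 b : b 1 = 0 -> 1 < b 19 ->
  \sum_(x <- [:: 3; 5; 11; 13; 17]) x ^ b x != 19 ^ b 19.
Proof.
move=> b1 b19; set s := [:: _; _; _; _; _].
pose xs := [seq if b x == 0 then 1 else x | x <- s].
have xs_in : xs \in choices s by apply: mem_choices.
have xs_ok : refuted min_exponent xs 19 := allP refuted_19 xs xs_in.
have -> : \sum_(x <- s) x ^ b x = \sum_(x <- xs) x ^ b x.
  by rewrite big_map; apply: eq_bigr => x _; case: eqP => // ->; rewrite exp1n.
apply: refutedP xs_ok _ _; first by rewrite size_map.
move=> x; rewrite inE => /predU1P[-> //|/mapP[z z_s ->]].
case: ifP => [_|/negbT]; first by rewrite b1.
rewrite -lt0n => b_gt0; rewrite (leq_trans _ b_gt0) //.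
by move: z_s; rewrite /min_exponent !inE; do 4 (case/orP=> [/eqP-> //|]); move/eqP->.
Qed.

(* Primes p_1..p_t are indexed 0..t-1 here; p (t-1) is the subtracted one.
   Exponents alpha_i are a i.  The equation sum - p_t^{alpha_t} = 0 over
   non-negative integers is stated as sum = p_t^{alpha_t} in nat. *)
Theorem theorem4 :
  (forall (t : nat) (p a : nat -> nat),
      3 <= t <= 6 ->
      (forall i j, i < t -> j < t -> p i = p j -> i = j) ->
      (forall i, i < t -> prime (p i) /\ p i <= 19) ->
      \sum_(i < t.-1) p i ^ a i = p t.-1 ^ a t.-1 ->
      exists2 i, i < t & a i <= 15)
  /\
  (forall a1 a2 a3 a4 a5 a6 : nat,
      3 ^ a1 + 5 ^ a2 + 11 ^ a3 + 13 ^ a4 + 17 ^ a5 = 19 ^ a6 <->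
      (a1, a2, a3, a4, a5, a6) = (0, 1, 1, 0, 0, 1)
      \/ (a1, a2, a3, a4, a5, a6) = (1, 0, 0, 1, 0, 1)).
Proof.
split=> [t p a t_bd p_inj p_prime sum_eq | a1 a2 a3 a4 a5 a6].
  have t_gt0 : 0 < t by case/andP: t_bd => /ltnW/ltnW.
  have lt_pred i : i < t.-1 -> i < t by move=> lt_i; rewrite (leq_trans lt_i) ?leq_pred.
  have lt_last : t.-1 < t by rewrite prednK.
  case: (boolP [exists i : 'I_t, a i <= 15]) => [/existsP[i le_ai]|].
    by exists i.
  rewrite negb_exists => /forallP a_gt15.
  (* The sieve indexes exponents by their base, which is possible as the primes are distinct. *)
  pose b x := a (index x [seq p i | i <- iota 0 t]).
  have p_uniq : uniq [seq p i | i <- iota 0 t].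
    rewrite map_inj_in_uniq ?iota_uniq // => i j.
    by rewrite !mem_iota => lt_i lt_j; apply: p_inj.
  have bE i : i < t -> b (p i) = a i.
    move=> lt_it; rewrite /b -[i in p i](nth_iota 0 0 lt_it) -(nth_map 0 0) ?size_iota //.
    by rewrite index_uniq ?size_map ?size_iota.
  pose s := [seq p i | i <- iota 0 t.-1].
  have mem_ps x : x \in p t.-1 :: s -> exists2 i, i < t & x = p i.
    rewrite inE => /predU1P[->|/mapP[i]]; first by exists t.-1.
    by rewrite mem_iota => lt_i ->; exists i => //; apply: lt_pred.
  have s_uniq : uniq (p t.-1 :: s).
    rewrite /= -rcons_uniq -map_rcons -cats1.
    by rewrite -(@iotaD 0 t.-1 1) addn1 prednK.
  have s_sub : {subset p t.-1 :: s <= radices}.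
    by move=> x /mem_ps[i lt_it ->]; apply: small_primes; case: (p_prime i lt_it).
  have s_size : 1 < size s <= 5.
    by rewrite size_map size_iota ltn_predRL -[_ <= 5]ltnS prednK.
  have le_b : {in p t.-1 :: s, forall x, 16 <= b x}.
    by move=> x /mem_ps[i lt_it ->]; rewrite bE // ltnNge (a_gt15 (Ordinal lt_it)).
  case/eqP: (no_solution16 s_uniq s_sub s_size le_b).
  rewrite bE // -sum_eq -(big_mkord xpredT (fun i => p i ^ a i)) /index_iota subn0.
  rewrite big_map; apply: eq_big_seq => i; rewrite mem_iota => lt_i.
  by rewrite bE // lt_pred.
split=> [sum_eq|[] [-> -> -> -> -> ->] //].
have [a6_gt1|a6_le1] := ltnP 1 a6.
  (* Since 1 is not among the bases listed, the default value gives [b 1 = 0]. *)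
  pose b x := nth 0 [:: a1; a2; a3; a4; a5; a6] (index x [:: 3; 5; 11; 13; 17; 19]).
  have /eqP[] := @no_solution19 b erefl a6_gt1.
  by rewrite !big_cons big_nil addn0 !addnA.
(* Now the sum is at most 19, which [3 ^ 3] and the squares of 5, 11, 13 and 17 exceed. *)
have small x n a : 1 < x -> 19 < x ^ n -> x ^ a <= 19 -> a < n.
  by move=> x_gt1 lt_19 le_19; rewrite -(ltn_exp2l _ _ x_gt1) (leq_ltn_trans le_19).
have sum_le : 3 ^ a1 + 5 ^ a2 + 11 ^ a3 + 13 ^ a4 + 17 ^ a5 <= 19.
  by rewrite sum_eq; case: a6 a6_le1 {sum_eq} => [|[]].
have [le_a1 le_a2 le_a3 le_a4 le_a5] :
    [/\ a1 < 3, a2 < 2, a3 < 2, a4 < 2 & a5 < 2].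
  by split; [apply: (small 3) | apply: (small 5) | apply: (small 11)
    | apply: (small 13) | apply: (small 17)] => //;
    apply: leq_trans sum_le; rewrite -?addnA;
    do ?[exact: leq_addr | apply: leq_trans (leq_addl _ _) => //].
move: sum_eq {sum_le small}.
by case: a1 le_a1 => [|[|[|//]]] _; case: a2 le_a2 => [|[|//]] _;
  case: a3 le_a3 => [|[|//]] _; case: a4 le_a4 => [|[|//]] _;
  case: a5 le_a5 => [|[|//]] _; case: a6 a6_le1 => [|[|//]] _ // _; auto.
Qed.
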